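(* Let $m \ge 1$ be a fixed integer and let $G_m^n$ be the preferential attachment random multigraph. Then asymptotically almost surely (as $n \to\infty$) $$ q^*(G_m^n) \ge \frac{1}{m}\,\mathbb{E}\left( \left| \mathrm{Bin}(m,1/2) - m/2 \right| \right) + o(1). $$ That is, asymptotically almost surely $$ q^*(G_m^n) \ge \begin{cases} \displaystyle \frac{2^{1-m}}{m} \sum_{i=1}^{m/2} i \binom{m}{m/2+i} + o(1) & \text{if } m \text{ is even}, \\[2ex] \displaystyle \frac{2^{1-m}}{m} \sum_{i=1}^{(m+1)/2} \left(i-\tfrac12\right) \binom{m}{(m-1)/2+i} + o(1) & \text{if } m \text{ is odd}. \end{cases} $$ In particular, asymptotically almost surely $q^*(G_m^n) = \Omega(1/\sqrt{m})$, i.e. there is an absolute constant $c>0$ such that for every fixed $m \ge 1$, asymptotically almost surely $q^*(G_m^n) \ge c/\sqrt{m}$.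
   Context: Preferential attachment model. Let $G_1^0$ be the null graph with no vertices. The process $(G_1^t)_{t\ge 0}$ is defined inductively: given $G_1^{t-1}$, form $G_1^t$ by adding a vertex $v_t$ together with a single edge between $v_t$ and $v_i$, where $i$ is chosen randomly with $\mathbb{P}(i=s) = \deg(v_s,t-1)/(2t-1)$ for $1\le s\le t-1$ and $\mathbb{P}(i=t) = 1/(2t-1)$; here $\deg(v_s,t-1)$ is the degree of $v_s$ in $G_1^{t-1}$ (loops counted twice). For $m\ge 2$, $G_m^t$ is obtained from $G_1^{tm}$, on vertices $v'_1,v'_2,\dots,v'_{tm}$, by identifying $v'_{(j-1)m+1},\dots,v'_{jm}$ to form the vertex $v_j$, for each $1\le j\le t$. $G_m^n$ is in general a multigraph with $mn$ edges, possibly with loops and multiple edges. Modularity: for a (multi)graph $G$ with at least one edge and a partition $\mathcal{A}$ of $V(G)$, $$q_{\mathcal{A}}(G) = \sum_{A \in \mathcal{A}} \left( \frac{e(A)}{|E(G)|} - \frac{(\sum_{v\in A}\deg(v))^2}{4|E(G)|^2}\right),$$ where $e(A)$ is the number of edges (counted with multiplicity, loops included) with both endpoints in $A$ and loops contribute $2$ to degrees. The modularity is $q^*(G) = \max_{\mathcal{A}} q_{\mathcal{A}}(G)$ over all partitions $\mathcal{A}$ of $V(G)$. $\mathrm{Bin}(m,1/2)$ is a binomial random variable with $m$ trials and success probability $1/2$. An event holds asymptotically almost surely if its probability tends to $1$ as $n\to\infty$; $o(1)$ denotes a deterministic sequence tending to $0$ as $n\to\infty$ with $m$ fixed. *)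

(* Defs.v *)
From HB Require Import structures.
From mathcomp Require Import all_boot all_order all_algebra.
From mathcomp Require Import all_classical all_reals all_analysis.

Set Implicit Arguments.
Unset Strict Implicit.
Unset Printing Implicit Defensive.

Import Order.TTheory GRing.Theory Num.Theory.
Import numFieldNormedType.Exports.

Local Open Scope ring_scope.

(* A finite multigraph on V is given by its list of edges; repetitions are
   parallel edges, pairs (v, v) are loops, and the order of the two ends of an
   edge (and of the edges in the list) is immaterial. *)
Definition mgraph (V : finType) : Type := seq (V * V).

(* A loop adds 2 to the degree of its vertex. *)
Definition deg (V : finType) (G : mgraph V) (v : V) : nat :=
  (\sum_(e <- G) ((e.1 == v) + (e.2 == v)))%N.

Definition edges_within (V : finType) (G : mgraph V) (A : {set V}) : nat :=
  count (fun e : V * V => (e.1 \in A) && (e.2 \in A)) G.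

Definition modularity_of (R : realType) (V : finType) (G : mgraph V)
    (P : {set {set V}}) : R :=
  \sum_(A in P)
     ((edges_within G A)%:R / (size G)%:R
      - ((\sum_(v in A) deg G v)%N)%:R ^+ 2 / (4 * (size G)%:R ^+ 2)).

(* The maximum over all partitions of V.  The one-block partition only serves
   as the initial element that [arg max] requires. *)
Definition modularity (R : realType) (V : finType) (G : mgraph V) : R :=
  modularity_of R G
    [arg max_(P > [set [set: V]] | finset.partition P [set: V]) modularity_of R G P]%O.

Definition identify (V W : finType) (f : V -> W) (G : mgraph V) : mgraph W :=
  [seq (f e.1, f e.2) | e <- G].

(* Vertices are numbered from 0, so the vertex v_(j+1) is j.  The choices
   made in the first N steps are recorded as x : {ffun 'I_N -> 'I_N}: the vertex
   j arrives with an edge to x j.  [pa_graph1 x t] is the graph after t steps,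
   whose vertices are the j < t (the other elements of 'I_N are isolated). *)
Definition pa_graph1 (N : nat) (x : {ffun 'I_N -> 'I_N}) (t : nat) :
    mgraph 'I_N :=
  [seq (j, x j) | j : 'I_N <- enum 'I_N & (j < t)%N].

(* The conditional probability, given the choices of the vertices before t,
   that the vertex t (the (t+1)-st to arrive) is joined to s; the denominator
   is 2 (t + 1) - 1. *)
Definition attach_prob (R : realType) (N : nat) (x : {ffun 'I_N -> 'I_N})
    (t s : 'I_N) : R :=
  if (s < t)%N then (deg (pa_graph1 x t) s)%:R / (2 * t + 1)%:R
  else if s == t then 1 / (2 * t + 1)%:R
  else 0.

(* The law of the choices of the first N steps (chain rule). *)
Definition pa_law (R : realType) (N : nat) (x : {ffun 'I_N -> 'I_N}) : R :=
  \prod_(t < N) attach_prob R x t (x t).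

Lemma block_subproof (n m : nat) (k : 'I_(n * m)) : (k %/ m < n)%N.
Proof.
case: k => k /=; case: m => [|m]; first by rewrite muln0.
by rewrite ltn_divLR.
Qed.

Definition block (n m : nat) (k : 'I_(n * m)) : 'I_n :=
  Ordinal (block_subproof k).

(* G_m^n as a function of the choices of the first nm steps. *)
Definition pa_graph (m n : nat) (x : {ffun 'I_(n * m) -> 'I_(n * m)}) :
    mgraph 'I_n :=
  identify (@block n m) (pa_graph1 x (n * m)).

Definition pa_prob (R : realType) (m n : nat) (E : mgraph 'I_n -> bool) : R :=
  \sum_(x : {ffun 'I_(n * m) -> 'I_(n * m)} | E (pa_graph x)) pa_law R x.

(* G_m^n satisfies E n asymptotically almost surely, as n tends to infinity. *)
Definition pa_aas (R : realType) (m : nat)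
    (E : forall n : nat, mgraph 'I_n -> bool) : Prop :=
  ((fun n : nat => pa_prob R m (E n)) @ \oo --> (1 : R))%classic.

(* a.a.s. q*(G_m^n) >= a + o(1), with o(1) a deterministic sequence. *)
Definition pa_modularity_aas_ge (R : realType) (m : nat) (a : R) : Prop :=
  exists2 eps : nat -> R,
    (eps @ \oo --> (0 : R))%classic &
    pa_aas R m (fun n (G : mgraph 'I_n) => a + eps n <= modularity R G).

(* E |Bin(m, 1/2) - m/2| *)
Definition binomial_mean_dev (R : realType) (m : nat) : R :=
  fine ('E_(binomial_prob m (2^-1 : R))
          [fun k : nat => (`|k%:R - m%:R / 2| : R)%R])%E.

(* Main.v *)
Require Import Defs.
From mathcomp Require Import all_boot all_order all_algebra.
From mathcomp Require Import all_classical all_reals all_analysis.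
From mathcomp Require Import zify ring lra.
Import Order.TTheory GRing.Theory Num.Theory.
Import numFieldNormedType.Exports.
Set Implicit Arguments.
Unset Strict Implicit.
Unset Printing Implicit Defensive.
Local Open Scope ring_scope.

(** The lower bound comes from a two-block partition that is built online, one
    vertex of G_m^n at a time.  When a vertex arrives, its m edges go to older
    vertices, and each of them lands in either block with probability
    proportional to the volume of that block.  If the two blocks have nearly the
    same volume, the m edges behave as m fair coins, so putting the new vertex in
    the block that receives most of its edges makes m/2 + |Bin(m, 1/2) - m/2| of
    them internal.  A balanced bipartition pays a degree tax of 1/2, hence the
    modularity is about E|Bin(m, 1/2) - m/2| / m.

    The balance of volumes is the only difficulty, since the majority rule
    reinforces the larger block: as long as it is small, an imbalance S may grow
    like a power of time whose exponent exceeds 1 when m is large.  But such a growth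
    only multiplies S by a constant while time goes from n/q to n.  So for the first
    n/q vertices the rule is to join the lighter block, which keeps |S| <= 2m
    deterministically, and the majority rule is used afterwards (ties going to the
    lighter block).
    The first n/q vertices cost at most 1/q in modularity.

    Both S and the accumulated deviation of the number of internal edges from its
    target are controlled by one potential, the sum of their squares, where among the
    m edges of a vertex each quantity is replaced by its forecast, that is, its mean
    if the remaining edges of the vertex were fair coins (coin_mean).  Fair
    coins leave forecasts unchanged on average, and the true bias of the edge drawn
    at time t is of order (|S| + m) / t, so one edge multiplies the mean of the potential by
    at most 1 + O(1/t) and adds O(1) (attach_mean_potential).  From the
    edge mn/q to the edge mn this yields a mean potential O(n) (pa_mean_potential_final), and
    Markov's inequality makes both quantities o(n) with high probability.
    Letting q grow slowly gives the o(1) (diagonal_limit).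

    The law of the process is handled on lists of targets: given the list l of
    the targets of the first t edges, the next target is uniform among the 2t + 1
    entries of ends l, the half-edges present plus the new vertex
    (sum_pa_law).  Finally E|Bin(m, 1/2) - m/2| >= sqrt m / 8 follows from the
    second and fourth moments of a sum of signs (coin_mean_abs_ge). *)

(** * Sums of fair signs *)

Section FairCoin.
Variable R : realType.
Implicit Types (f g : R -> R) (r : nat) (x y c : R).

(** The mean of f (y + X), X being a sum of r independent fair signs.  The
    recursion on the first sign is the martingale property that drives the
    potential argument. *)
Fixpoint coin_mean r f y : R :=
  if r is r'.+1 then (coin_mean r' f (y + 1) + coin_mean r' f (y - 1)) / 2
  else f y.

Lemma coin_meanS r f y :
  coin_mean r.+1 f y = (coin_mean r f (y + 1) + coin_mean r f (y - 1)) / 2.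
Proof. by []. Qed.

Lemma eq_coin_mean r f g : f =1 g -> coin_mean r f =1 coin_mean r g.
Proof. by move=> fg; elim: r => [|r IHr] y /=; rewrite ?IHr. Qed.

Lemma le_coin_mean r f g y :
  (forall x, f x <= g x) -> coin_mean r f y <= coin_mean r g y.
Proof.
move=> fg; elim: r y => [|r IHr] y //=.
by have := IHr (y + 1); have := IHr (y - 1); lra.
Qed.

Lemma coin_mean_add r f c y : coin_mean r (fun x => f x + c) y = coin_mean r f y + c.
Proof. by elim: r y => [|r IHr] y //=; rewrite !IHr; field. Qed.

Lemma coin_mean_comb r (a b : R) f g y :
  coin_mean r (fun x => a * f x + b * g x) y
    = a * coin_mean r f y + b * coin_mean r g y.
Proof. by elim: r y => [|r IHr] y //=; rewrite !IHr; field. Qed.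

Lemma coin_mean_id r y : coin_mean r id y = y.
Proof. by elim: r y => [|r IHr] y //=; rewrite !IHr; field. Qed.

Lemma coin_mean_near_id r f c y :
  (forall x, `|f x - x| <= c) -> `|coin_mean r f y - y| <= c.
Proof.
move=> fc; elim: r y => [|r IHr] y; first exact: fc.
have := IHr (y + 1); have := IHr (y - 1).
by rewrite coin_meanS !ler_norml => /andP[? ?] /andP[? ?]; apply/andP; split; lra.
Qed.

Lemma coin_mean_lipschitz r f x y :
  (forall x y, `|f x - f y| <= `|x - y|) ->
  `|coin_mean r f x - coin_mean r f y| <= `|x - y|.
Proof.
move=> fL; elim: r x y => [|r IHr] x y; first exact: fL.
have := IHr (x + 1) (y + 1); have := IHr (x - 1) (y - 1).
rewrite (_ : x - 1 - (y - 1) = x - y); last by ring.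
rewrite (_ : x + 1 - (y + 1) = x - y); last by ring.
rewrite !coin_meanS !ler_norml => /andP[? ?] /andP[? ?].
by apply/andP; split; lra.
Qed.

Lemma coin_mean_odd r f :
  (forall x, f (- x) = - f x) -> coin_mean r f 0 = 0.
Proof.
move=> fodd; suff H y : coin_mean r f (- y) = - coin_mean r f y.
  by have := H 0; rewrite oppr0; lra.
elim: r y => [|r IHr] y //=.
rewrite (_ : - y + 1 = - (y - 1)); last by ring.
rewrite (_ : - y - 1 = - (y + 1)); last by ring.
by rewrite !IHr; field.
Qed.

Lemma coin_mean_sqr r y : coin_mean r (fun x => x ^+ 2) y = y ^+ 2 + r%:R.
Proof. by elim: r y => [|r IHr] y /=; rewrite ?addr0// !IHr -natr1; field. Qed.

Lemma coin_mean_pow4 r y : coin_mean r (fun x => x ^+ 4) y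
  = y ^+ 4 + 6 * r%:R * y ^+ 2 + 3 * r%:R ^+ 2 - 2 * r%:R.
Proof. by elim: r y => [|r IHr] y /=; [ring|rewrite !IHr -natr1; field]. Qed.

(** Hoelder's inequality between the moments of orders 1, 2 and 4 in a pointwise
    form: with s = sqrt r and u = |x| / s one has u >= u ^ 2 - u ^ 4 / 4, and the
    means of the two powers are 1 and at most 3. *)
Lemma coin_mean_abs_ge r : Num.sqrt r%:R / 4 <= coin_mean r (@Num.norm R R) 0.
Proof.
case: r => [|r]; first by rewrite sqrtr0 mul0r /= normr0.
set s := Num.sqrt _.
have s0 : 0 < s by rewrite sqrtr_gt0 ltr0n.
have s2 : s ^+ 2 = r.+1%:R by rewrite sqr_sqrtr// ler0n.
have bnd x : s^-1 * x ^+ 2 + (- (4 * s ^+ 3)^-1) * x ^+ 4 <= `|x|.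
  rewrite -(@real_normK _ x) ?num_real// (_ : x ^+ 4 = `|x| ^+ 4); last first.
    by rewrite (exprM x 2 2) -(@real_normK _ x) ?num_real// -exprM.
  have := normr_ge0 x; move: `|x| => t t0.
  set u := t / s; have u0 : 0 <= u by rewrite divr_ge0// ltW.
  have -> : t = u * s by rewrite /u divfK// gt_eqF.
  have -> : s^-1 * (u * s) ^+ 2 + - (4 * s ^+ 3)^-1 * (u * s) ^+ 4
     = s * (u ^+ 2 - u ^+ 4 / 4) by field; rewrite gt_eqF.
  rewrite mulrC ler_pM2r//.
  rewrite -subr_ge0 (_ : _ - _ = u * (1 - u + u ^+ 3 / 4)); last by field.
  apply: mulr_ge0 => //.
  (* the tangent to u ^ 3 at 6/5, close to the minimiser of 1 - u + u ^ 3 / 4 *)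
  have : 0 <= (u + 12/5) * (u - 6/5) ^+ 2 by rewrite mulr_ge0 ?sqr_ge0//; lra.
  rewrite (_ : (u + _) * _ = u ^+ 3 - 108/25 * u + 432/125); last by field.
  lra.
apply: le_trans (le_coin_mean r.+1 0 bnd).
rewrite coin_mean_comb coin_mean_sqr coin_mean_pow4 -s2.
rewrite -subr_ge0.
rewrite (_ : _ - _ = (2 * s)^-1); last by field; rewrite gt_eqF.
by rewrite invr_ge0 mulr_ge0// ltW.
Qed.

Lemma coin_meanE r f y : coin_mean r f y =
  \sum_(k < r.+1) 'C(r, k)%:R / 2 ^+ r * f (y + k%:R * 2 - r%:R).
Proof.
elim: r y => [|r IHr] y.
  by rewrite big_ord1 /= bin0 expr0 divr1 mul1r mul0r addr0 subr0.
rewrite coin_meanS !IHr [in RHS]big_ord_recl /= bin0.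
rewrite [in RHS](eq_bigr (fun i : 'I_r.+1 =>
   'C(r, i)%:R / 2 ^+ r.+1 * f (y + 1 + i%:R * 2 - r%:R)
   + 'C(r, i.+1)%:R / 2 ^+ r.+1 * f (y - 1 + i.+1%:R * 2 - r%:R))); last first.
  move=> i _; rewrite /bump /= add1n binS natrD.
  rewrite (_ : y + i.+1%:R * 2 - r.+1%:R = y + 1 + i%:R * 2 - r%:R); last by rewrite -!natr1; ring.
  rewrite (_ : y - 1 + i.+1%:R * 2 - r%:R = y + 1 + i%:R * 2 - r%:R); last by rewrite -!natr1; ring.
  by ring.
rewrite big_split /= addrCA mulrDl; congr (_ + _).
  rewrite mulr_suml; apply: eq_bigr => i _.
  by rewrite exprS invfM; move: (_ ^- r) (f _) => ? ?; field.
rewrite [in RHS]big_ord_recr /= bin_small// !mul0r !addr0.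
rewrite big_ord_recl /= bin0 mulrDl; congr (_ + _).
  rewrite mulr0n !mul0r !addr0 (_ : y - 1 - r%:R = y - r.+1%:R); last by rewrite -natr1; ring.
  by rewrite exprS invfM; move: (_ ^- r) (f _) => ? ?; field.
rewrite mulr_suml; apply: eq_bigr => i _.
by rewrite /bump /= add1n exprS invfM; move: (_ ^- r) (f _) => ? ?; field.
Qed.

End FairCoin.

(** * Preferential attachment on lists of targets *)

Section ListProcess.
Variable R : realType.
Implicit Types (F G : seq nat -> R) (l : seq nat).

(** The vertex k < size l has one half-edge from its own edge and one for each
    occurrence of k in l, so a uniform entry of ends l is an older vertex chosen
    proportionally to its degree, or the new vertex size l with weight 1. *)
Definition ends l : seq nat := iota 0 (size l).+1 ++ l.

Definition valid l : bool := all (fun k => (nth 0 l k <= k)%N) (iota 0 (size l)).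

Definition attach_mean F l : R :=
  (\sum_(s <- ends l) F (rcons l s)) / (size (ends l))%:R.

Fixpoint pa_mean t F : R :=
  if t is t'.+1 then pa_mean t' (attach_mean F) else F [::].

Lemma size_ends l : size (ends l) = (2 * size l + 1)%N.
Proof. by rewrite size_cat size_iota mul2n -addnn addnAC addn1. Qed.

Lemma valid_rcons l s : valid (rcons l s) = valid l && (s <= size l)%N.
Proof.
rewrite /valid size_rcons -addn1 iotaD all_cat add0n /= andbT.
congr (_ && _); last by rewrite nth_rcons ltnn eqxx.
by apply: eq_in_all => k; rewrite mem_iota /= => kl; rewrite nth_rcons kl.
Qed.

Lemma valid_nth l k : valid l -> (nth 0 l k <= k)%N.
Proof.
move=> /allP vl; have [kl|lk] := ltnP k (size l); last by rewrite nth_default.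
by apply: vl; rewrite mem_iota.
Qed.

Lemma valid_ends l s : valid l -> s \in ends l -> (s <= size l)%N.
Proof.
move=> vl; rewrite mem_cat mem_iota /= add0n ltnS => /orP[//|/(nthP 0)[k kl <-]].
by rewrite (leq_trans (valid_nth k vl))// ltnW.
Qed.

(** A list drawn by the process is valid, so only valid lists matter. *)
Lemma le_pa_mean t F G :
  (forall l, size l = t -> valid l -> F l <= G l) -> pa_mean t F <= pa_mean t G.
Proof.
elim: t F G => [|t IHt] F G FG /=; first exact: FG.
apply: IHt => l lt vl; rewrite ler_wpM2r ?invr_ge0//.
rewrite ![\sum_(s <- _) _]big_seq; apply: ler_sum => s sl.
by apply: FG; rewrite ?size_rcons ?lt// valid_rcons vl valid_ends.
Qed.

Lemma eq_pa_mean t F G :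
  (forall l, size l = t -> valid l -> F l = G l) -> pa_mean t F = pa_mean t G.
Proof.
by move=> FG; apply/le_anti/andP; split; apply: le_pa_mean => l lt vl; rewrite FG.
Qed.

Lemma attach_mean_affine (a b : R) F l :
  attach_mean (fun l => a * F l + b) l = a * attach_mean F l + b.
Proof.
rewrite /attach_mean big_split /= -mulr_sumr mulrDl mulrA; congr (_ + _).
rewrite big_const_seq iter_addr addr0 count_predT -[b *+ _]mulr_natr mulfK//.
by rewrite size_ends pnatr_eq0 addn1.
Qed.

Lemma pa_mean_affine t (a b : R) F :
  pa_mean t (fun l => a * F l + b) = a * pa_mean t F + b.
Proof.
elim: t F => [//|t IHt] F /=; rewrite -IHt.
by apply: eq_pa_mean => l _ _; rewrite attach_mean_affine.
Qed.

Lemma pa_mean_cst t (b : R) : pa_mean t (fun=> b) = b.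
Proof.
transitivity (0 * pa_mean t (fun=> 0) + b); last by rewrite mul0r add0r.
by rewrite -pa_mean_affine; apply: eq_pa_mean => l _ _; rewrite mul0r add0r.
Qed.

End ListProcess.

(** * The online bipartition *)

Section Coloring.
Variables (R : realType) (m j0 : nat) (mu : R).
Hypothesis m_gt0 : (0 < m)%N.

(** The blocks of the partition are the labels 1 and -1.  In a state, lab lists the
    labels of the completed vertices of G_m^n, pos counts the edges already drawn
    by the current vertex, ysum is the sum of the labels at the other ends of
    these edges and loops counts those that are loops.  The signed volume of the
    completed vertices at the beginning of the current vertex is vol; gain sums
    the excess of |ysum| over the target mu after the balancing phase. *)
Record coloring := Coloring {
  lab : seq R; pos : nat; ysum : R; loops : nat; vol : R; gain : R }.

Definition balancing (v : R) : R := if v <= 0 then 1 else -1.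

(** Ties must go to the lighter block: a fixed choice would give vol a drift of
    constant size. *)
Definition majority (v y : R) : R :=
  if 0 < y then 1 else if y < 0 then -1 else balancing v.

Definition new_label (burn : bool) (v y : R) : R :=
  if burn then balancing v else majority v y.

(** The current vertex has no label yet, and reads as 0 beyond the end of lab; this
    makes its loops invisible to ysum. *)
Definition col_add st s := Coloring (lab st) (pos st).+1
  (ysum st + (lab st)`_(s %/ m))
  (loops st + (size (lab st) <= s %/ m))%N (vol st) (gain st).

Definition col_close st :=
  if pos st != m then st else
  let j := size (lab st) in
  let L := new_label (j < j0)%N (vol st) (ysum st) in
  Coloring (rcons (lab st) L) 0 0 0
    (vol st + ysum st + (m + loops st)%:R * L)
    (gain st + if (j < j0)%N then 0 else `|ysum st| - mu).

Definition run (l : seq nat) : coloring :=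
  foldl (fun st s => col_close (col_add st s)) (Coloring [::] 0 0 0 0 0) l.

Lemma run_rcons l s : run (rcons l s) = col_close (col_add (run l) s).
Proof. by rewrite /run -cats1 foldl_cat. Qed.

Definition esum (l : seq nat) (F : nat -> nat -> R) : R :=
  \sum_(k < size l) F (k %/ m)%N (nth 0%N l k %/ m)%N.

Lemma esum_rcons l s F :
  esum (rcons l s) F = esum l F + F (size l %/ m)%N (s %/ m)%N.
Proof.
rewrite /esum size_rcons big_ord_recr /= nth_rcons ltnn eqxx; congr (_ + _).
by apply: eq_bigr => i _; rewrite nth_rcons ltn_ord.
Qed.

(** What relates a state to the multigraph drawn so far.  In inv_gain every vertex of
    the balancing phase is charged the worst case - m. *)
Record col_inv (l : seq nat) (st : coloring) : Prop := ColInv {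
  inv_size : size l = (size (lab st) * m + pos st)%N;
  inv_pos : (pos st <= m)%N;
  inv_lab : forall i, (i < size (lab st))%N -> (lab st)`_i = 1 \/ (lab st)`_i = -1;
  inv_loops : (loops st <= pos st)%N;
  inv_vol : esum l (fun a b => (lab st)`_a + (lab st)`_b) = vol st + ysum st;
  inv_ysum : `|ysum st| <= (pos st)%:R - (loops st)%:R;
  inv_esum_loops : esum l (fun a b => (b == size (lab st))%:R) = (loops st)%:R;
  inv_esum_pos : esum l (fun a b => (a == size (lab st))%:R) = (pos st)%:R;
  inv_esum_ysum :
    esum l (fun a b => (a == size (lab st))%:R * (lab st)`_b) = ysum st;
  inv_gain : gain st + \sum_(i < size (lab st)) (if (i < j0)%N then - m%:R else mu)
    <= esum l (fun a b => (lab st)`_a * (lab st)`_b);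
  inv_burn : (size (lab st) <= j0)%N -> `|vol st| <= 2 * m%:R /\ gain st = 0 }.

Lemma col_inv_add l st s : col_inv l st -> (pos st < m)%N -> (s <= size l)%N ->
  col_inv (rcons l s) (col_add st s).
Proof.
case=> i1 i2 i3 i4 i5 i6 i7 i8 i9 i10 i11 ltm sl.
have aj : (size l %/ m = size (lab st))%N by rewrite i1 divnMDl// divn_small// addn0.
have bj : (s %/ m <= size (lab st))%N by rewrite -aj leq_div2r.
have labj : (lab st)`_(size (lab st)) = 0 by rewrite nth_default.
have Ej : (size (lab st) <= s %/ m)%N = (s %/ m == size (lab st))%N.
  by rewrite eqn_leq bj.
split; rewrite /= ?esum_rcons ?aj ?labj ?eqxx ?Ej //.
- by rewrite size_rcons i1 addnS.
- by rewrite -[X in (_ <= X)%N]addn1 leq_add// leq_b1.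
- by rewrite i5 add0r addrA.
- rewrite -natr1 natrD; case: eqP => [->|/eqP ne].
    by rewrite labj addr0 (le_trans i6)//= mulr1n; lra.
  have : (s %/ m < size (lab st))%N by rewrite ltn_neqAle ne.
  move: i6; rewrite ler_norml mulr0n => /andP[? ?].
  by move=> /i3[|] ->; rewrite ler_norml; apply/andP; split; lra.
- by rewrite i7 natrD.
- by rewrite i8 natr1.
- by rewrite i9 mul1r.
- by rewrite mul0r addr0.
Qed.

Lemma new_label_sign b v y : new_label b v y = 1 \/ new_label b v y = -1.
Proof.
by rewrite /new_label /majority /balancing; do !case: ifP => _; by [left|right].
Qed.

Lemma mul_majority v y : majority v y * y = `|y|.
Proof.
rewrite /majority; case: ltP => [y0|y0]; first by rewrite mul1r gtr0_norm.
case: ltP => [y1|y1]; first by rewrite mulN1r ltr0_norm.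
have -> : y = 0 by apply/le_anti; rewrite y0 y1.
by rewrite mulr0 normr0.
Qed.

(** Labelling the current vertex adds its label times m + loops to the signed volume,
    m for its own half-edges and loops for the others.  Its label times ysum, plus
    loops, is added to the sum of the products of labels over the edges. *)
Lemma col_inv_close l st : valid l -> col_inv l st -> col_inv l (col_close st).
Proof.
move=> vl inv; rewrite /col_close; case: eqP => //= pm.
case: inv => i1 _ i3 i4 i5 i6 i7 i8 i9 i10 i11; rewrite pm in i1 i4 i6 i8.
set j := size (lab st) in i1 i3 i7 i8 i9 i10 i11 *.
set L := new_label _ _ _.
have L1 : L = 1 \/ L = -1 by exact: new_label_sign.
have labr i : (rcons (lab st) L)`_i = (lab st)`_i + (i == j)%:R * L.
  rewrite nth_rcons -/j; case: ltngtP => ij; rewrite ?mul0r ?addr0//.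
    by rewrite nth_default// ltnW.
  by rewrite ij nth_default// add0r mul1r.
have alej (k : 'I_(size l)) : (k %/ m <= j)%N.
  by rewrite -ltnS ltn_divLR// mulSn addnC -i1.
have blea (k : 'I_(size l)) : (nth 0 l k %/ m <= k %/ m)%N.
  by rewrite leq_div2r// valid_nth.
split; rewrite /= ?size_rcons -/j.
- by rewrite i1 mulSn addn0 addnC.
- by [].
- move=> i; rewrite ltnS leq_eqVlt => /orP[/eqP->|ij]; rewrite labr.
    by rewrite eqxx mul1r nth_default// add0r.
  by rewrite (ltn_eqF ij) mul0r addr0; exact: i3.
- by [].
- rewrite addr0 -i5 natrD mulrDl -i8 -i7 /esum !mulr_suml -!big_split /=.
  by apply: eq_bigr => k _; rewrite !labr; ring.
- by rewrite normr0 subrr.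
- rewrite /esum big1// => k _; rewrite ltn_eqF// ltnS.
  exact: leq_trans (blea k) (alej k).
- by rewrite /esum big1// => k _; rewrite ltn_eqF// ltnS alej.
- by rewrite /esum big1// => k _; rewrite ltn_eqF ?mul0r// ltnS alej.
- rewrite big_ord_recr /=.
  have -> : esum l (fun a b => (rcons (lab st) L)`_a * (rcons (lab st) L)`_b) =
      esum l (fun a b => (lab st)`_a * (lab st)`_b) + L * ysum st + (loops st)%:R.
    rewrite -i9 -i7 /esum mulr_sumr -!big_split /=.
    apply: eq_bigr => k _; rewrite !labr.
    have := alej k; have := blea k; case: (eqVneq (nth 0 l k %/ m)%N j) => [->|ne].
      move=> ja aj; have -> : (k %/ m = j)%N by apply/eqP; rewrite eqn_leq aj ja.
      by rewrite eqxx nth_default//=; case: L1 => ->; ring.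
    by move=> _ _ /=; ring.
  move: i10; set Y := esum _ _; set B := \sum_(_ < _) _.
  rewrite /L; case: ifP => jj0 H.
    have := new_label_sign true (vol st) (ysum st).
    have : (0 : R) <= (loops st)%:R by [].
    move: i6; rewrite ler_norml => /andP[? ?] ?.
    by case=> ->; lra.
  have : (0 : R) <= (loops st)%:R by [].
  by rewrite /new_label mul_majority; lra.
- move=> jj0; have [vb g0] := i11 (ltnW jj0).
  rewrite g0 jj0 addr0; split=> //; rewrite /L jj0 /new_label /balancing.
  have : (0 : R) <= (loops st)%:R by [].
  move: vb i6; rewrite natrD !ler_norml => /andP[? ?] /andP[? ?] ?.
  by case: ifP => v0; last (move/negbT: v0; rewrite -ltNge => v0);
    rewrite ?mulr1 ?mulrN1; apply/andP; split; lra.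
Qed.

Lemma pos_close st : (pos st <= m)%N -> (pos (col_close st) < m)%N.
Proof.
by move=> pm; rewrite /col_close; case: eqP => //= /eqP pn; rewrite ltn_neqAle pn.
Qed.

Lemma run_inv l : valid l -> col_inv l (run l) /\ (pos (run l) < m)%N.
Proof.
elim/last_ind: l => [_|l s IHl].
  split=> //=; split=> //=; rewrite ?/esum ?big_ord0 ?addr0 ?normr0 ?subrr//.
rewrite valid_rcons => /andP[vl sl]; have [inv pm] := IHl vl; rewrite run_rcons.
split; last by apply: pos_close.
apply: col_inv_close; first by rewrite valid_rcons vl.
exact: col_inv_add.
Qed.

End Coloring.

(** * Drift of the potential *)

Section Potential.
Variables (R : realType) (m j0 : nat).
Hypothesis m_gt0 : (0 < m)%N.

Definition mean_abs : R := coin_mean m (@Num.norm R R) 0.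

Local Notation run := (run m j0 mean_abs).
Local Notation col_close := (col_close m j0 mean_abs).
Local Notation col_add := (@col_add R m).
Local Notation col_inv := (@col_inv R m j0 mean_abs).

(** The mean of the signed volume at the end of the current vertex, if its r edges
    still to come were fair coins and its label is the majority one. *)
Definition vol_forecast r v w y : R :=
  v + coin_mean r (fun x => x + (m + w)%:R * majority v x) y.

Definition gain_forecast r g y : R :=
  g + coin_mean r (fun x => `|x| - mean_abs) y.

Definition potential (st : coloring R) : R :=
  vol_forecast (m - pos st) (vol st) (loops st) (ysum st) ^+ 2
  + gain_forecast (m - pos st) (gain st) (ysum st) ^+ 2.

Lemma vol_forecast_near r v w y : (w <= m)%N ->
  `|vol_forecast r v w y - (v + y)| <= 2 * m%:R.
Proof.
move=> wm; rewrite /vol_forecast opprD addrACA subrr add0r.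
apply: coin_mean_near_id => x; rewrite addrAC subrr add0r normrM.
have -> : `|majority v x| = 1.
  by case: (new_label_sign false v x) => /= ->; rewrite ?normrN normr1.
rewrite mulr1 ger0_norm// natrD.
have : (w%:R : R) <= m%:R by rewrite ler_nat.
lra.
Qed.

(** The tie-breaking rule pushes vol towards 0, so at the start of a vertex the
    forecast differs from v by a term h of absolute value at most m with v h <= 0. *)
Lemma vol_forecast_start v : vol_forecast m v 0 0 ^+ 2 <= v ^+ 2 + m%:R ^+ 2.
Proof.
rewrite /vol_forecast addn0; set h := coin_mean _ _ _.
have odd0 : coin_mean m (fun x : R => x + m%:R * Num.sg x) 0 = 0.
  by apply: coin_mean_odd => x; rewrite sgrN mulrN opprD.
have m0 : (0 : R) <= m%:R by [].
(* the majority label is odd in x, except for the tie *)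
have majE x : majority v x = Num.sg x + (x == 0)%:R * balancing v.
  rewrite /majority; case: (ltgtP 0 x) => x0.
  - by rewrite gtr0_sg// mul0r addr0.
  - by rewrite ltr0_sg// mul0r addr0.
  - by rewrite -x0 sgr0 mul1r add0r.
have b01 (x : R) : (0 : R) <= (x == 0)%:R <= (1 : R) by case: eqP => _; rewrite /= ?ler01 ?lexx.
rewrite /balancing in majE.
have [v0|v0] := leP v 0.
  have h0 : 0 <= h.
    rewrite -[0]odd0; apply: le_coin_mean => x; rewrite majE v0 mulr1.
    by rewrite lerD2l ler_wpM2l// lerDl; case/andP: (b01 x).
  have hm : h <= m%:R.
    rewrite -[X in _ <= X]add0r -[0 in X in _ <= X]odd0 -coin_mean_add.
    apply: le_coin_mean => x; rewrite majE v0 mulr1 mulrDr addrA lerD2l.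
    by rewrite ler_piMr//; case/andP: (b01 x).
  by nra.
have h0 : h <= 0.
  rewrite -[0 in X in _ <= X]odd0; apply: le_coin_mean => x.
  rewrite majE (lt_geF v0) /= mulrN1 lerD2l ler_wpM2l// gerBl; by case/andP: (b01 x).
have hm : - m%:R <= h.
  rewrite -[X in X <= _]add0r -[0 in X in X <= _]odd0 -coin_mean_add.
  apply: le_coin_mean => x; rewrite majE (lt_geF v0) /= mulrN1 mulrBr addrA lerD2l.
  by rewrite lerN2 ler_piMr//; case/andP: (b01 x).
by nra.
Qed.

Lemma gain_forecast_start g : gain_forecast m g 0 = g.
Proof. by rewrite /gain_forecast coin_mean_add subrr addr0. Qed.

Lemma potential_close st : (j0 <= size (lab st))%N ->
  potential (col_close st) <= potential st + m%:R ^+ 2.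
Proof.
move=> jj0; rewrite /col_close; case: eqP => [pm|_] /=; last first.
  by rewrite lerDl sqr_ge0.
rewrite ltnNge jj0 /= /potential /= pm subnn subn0 gain_forecast_start.
rewrite [X in _ <= X ^+ 2 + _ + _]/vol_forecast.
rewrite [X in _ <= _ + X ^+ 2 + _]/gain_forecast /= [leRHS]addrAC lerD2r addrA.
exact: vol_forecast_start.
Qed.

(** The sum of squares after one random step from a: ell is the sign of the step, z
    marks the exceptional outcomes, and d, e are the corresponding increments.  Only the
    total sign and the number of exceptions contribute to first order. *)
Lemma sum_sqr_drift (T : eqType) (r : seq T) (u ell z : T -> R) (a d e c : R) :
  (forall i, i \in r -> u i = a + ell i * d + z i * e) ->
  (forall i, i \in r -> `|u i - a| <= c) ->
  `|d| <= c -> `|e| <= c -> (forall i, 0 <= z i) ->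
  \sum_(i <- r) u i ^+ 2 <=
    (size r)%:R * (a ^+ 2 + c ^+ 2)
    + 2 * c * `|a| * (`|\sum_(i <- r) ell i| + \sum_(i <- r) z i).
Proof.
move=> uE uc dc ec z0.
have c0 : 0 <= c by apply: le_trans dc.
have sz0 : 0 <= \sum_(i <- r) z i by apply: sumr_ge0.
have drift : 2 * a * (\sum_(i <- r) (u i - a)) <=
    2 * c * `|a| * (`|\sum_(i <- r) ell i| + \sum_(i <- r) z i).
  rewrite (le_trans (ler_norm _))// !normrM normr_nat -!mulrA ler_pM2l//.
  rewrite mulrCA; apply: ler_wpM2l => //.
  have -> : \sum_(i <- r) (u i - a) =
      (\sum_(i <- r) ell i) * d + (\sum_(i <- r) z i) * e.
    rewrite !mulr_suml -big_split /= big_seq [RHS]big_seq.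
    by apply: eq_bigr => i ir; rewrite uE//; ring.
  rewrite mulrDr (le_trans (ler_normD _ _))// !normrM lerD//.
    by rewrite mulrC ler_wpM2r.
  by rewrite mulrC (ger0_norm sz0) ler_wpM2r.
have sqr : \sum_(i <- r) (u i - a) ^+ 2 <= (size r)%:R * c ^+ 2.
  apply: (@le_trans _ _ (\sum_(i <- r) c ^+ 2)); last first.
    by rewrite big_const_seq iter_addr addr0 count_predT mulr_natl.
  rewrite big_seq [leRHS]big_seq; apply: ler_sum => i ir.
  by rewrite -real_normK ?num_real// lerXn2r ?nnegrE ?uc.
have -> : \sum_(i <- r) u i ^+ 2 = (size r)%:R * a ^+ 2
    + 2 * a * (\sum_(i <- r) (u i - a)) + \sum_(i <- r) (u i - a) ^+ 2.
  rewrite mulr_natl -[size r]count_predT -[_ *+ _]addr0 -iter_addr -big_const_seq.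
  by rewrite mulr_sumr -!big_split /=; apply: eq_bigr => i _; ring.
lra.
Qed.

Lemma sum_ends (f : nat -> R) (l : seq nat) :
  \sum_(s <- ends l) f s = \sum_(k < size l) (f k + f (nth 0%N l k)) + f (size l).
Proof.
rewrite /ends big_cat -[X in iota _ X]addn1 iotaD big_cat add0n big_seq1 big_split /=.
rewrite addrAC; congr (_ + _ + _).
  by rewrite -(big_mkord xpredT) /index_iota subn0.
by rewrite (big_nth 0%N) big_mkord.
Qed.

(** A generous bound for all the constants of one step: increments are at most 5 m, and
    the first order term brings a further factor of order m ^ 2. *)
Definition drift_const : R := 211 * m%:R ^+ 3.

(** Under fair coins each forecast is a martingale.  The signs of the labels over the
    half-edges sum to vol + ysum, which is within 2m of the volume forecast, and at
    most 2m of the 2t + 1 half-edges belong to the current vertex.  So the first order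
    term is at most (potential + 1) / (2t + 1), up to a factor depending on m. *)
Lemma attach_mean_potential l : valid l -> (m * j0 <= size l)%N ->
  attach_mean (fun l => potential (run l)) l <=
    (1 + drift_const / (2 * size l + 1)%:R) * potential (run l) + drift_const.
Proof.
move=> vl jl; have [inv pm] := run_inv j0 mean_abs m_gt0 vl.
set st := run l in inv pm *.
set j := size (lab st); set v := vol st; set g := gain st; set w := loops st.
set y := ysum st.
have jj0 : (j0 <= j)%N.
  rewrite -ltnS -(ltn_pmul2r m_gt0) mulnC (leq_ltn_trans jl)//.
  by rewrite (inv_size inv) mulSn addnC ltn_add2r.
have [r er] : exists r, (m - pos st = r.+1)%N.
  by exists (m - (pos st).+1)%N; rewrite subnSK.
have er' : (m - (pos st).+1 = r)%N by rewrite subnS er.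
have wp : (w <= pos st)%N by exact: inv_loops inv.
have aj : (size l %/ m = j)%N.
  by rewrite (inv_size inv) divnMDl// divn_small// addn0.
(* the label of the next target is ell, and z marks a loop *)
pose ell s := (lab st)`_(s %/ m).
pose z s : R := (j <= s %/ m)%:R.
pose uv s := vol_forecast r v (w + (j <= s %/ m)) (y + ell s).
pose ug s := gain_forecast r g (y + ell s).
pose A := vol_forecast r.+1 v w y.
pose B := gain_forecast r.+1 g y.
have potE : potential st = A ^+ 2 + B ^+ 2 by rewrite /potential er.
set c : R := 5 * m%:R.
have m1 : (1 : R) <= m%:R by rewrite ler1n.
have step s : potential (run (rcons l s)) <= uv s ^+ 2 + ug s ^+ 2 + m%:R ^+ 2.
  rewrite run_rcons; apply: (le_trans (potential_close _)) => //=.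
  by rewrite /potential /= er'.
have cases s : (ell s = 1 /\ (j <= s %/ m)%N = false) \/
    (ell s = -1 /\ (j <= s %/ m)%N = false) \/
    (ell s = 0 /\ (j <= s %/ m)%N = true).
  rewrite /ell; case: (leqP j (s %/ m)) => js.
    by right; right; rewrite nth_default.
  by case: (inv_lab inv js) => ->; [left|right; left].
have cv : 4 * m%:R + 1 <= c by rewrite /c; lra.
(* increments of both forecasts along a sign, and at a loop *)
pose dv := (vol_forecast r v w (y + 1) - vol_forecast r v w (y - 1)) / 2.
pose ev := vol_forecast r v w.+1 y - A.
pose dg := (gain_forecast r g (y + 1) - gain_forecast r g (y - 1)) / 2.
pose eg := gain_forecast r g y - B.
have AE : A = (vol_forecast r v w (y + 1) + vol_forecast r v w (y - 1)) / 2.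
  by rewrite /A /vol_forecast coin_meanS; field.
have BE : B = (gain_forecast r g (y + 1) + gain_forecast r g (y - 1)) / 2.
  by rewrite /B /gain_forecast coin_meanS; field.
have wm : (w <= m)%N by rewrite (leq_trans wp)// ltnW.
have wm1 : (w.+1 <= m)%N by apply: leq_ltn_trans pm.
have dvc : `|dv| <= c.
  have := vol_forecast_near r v (y + 1) wm; have := vol_forecast_near r v (y - 1) wm.
  rewrite /dv !ler_norml => /andP[? ?] /andP[? ?]; apply/andP; split; lra.
have evc : `|ev| <= c.
  have := vol_forecast_near r v y wm1; have := vol_forecast_near r.+1 v y wm.
  rewrite /ev -/A !ler_norml => /andP[? ?] /andP[? ?]; apply/andP; split; lra.
have lipg x x' : `|gain_forecast r g x - gain_forecast r g x'| <= `|x - x'|.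
  rewrite /gain_forecast opprD addrACA subrr add0r.
  apply: coin_mean_lipschitz => a b.
  rewrite (_ : _ - _ = `|a| - `|b|); last by ring.
  exact: ler_dist_dist.
have n2 : `|y + 1 - (y - 1)| = 2 by rewrite (_ : _ - _ = 2) ?normr_nat//; ring.
have dgc : `|dg| <= c.
  rewrite normrM (@ger0_norm _ 2^-1)//.
  have := lipg (y + 1) (y - 1); rewrite n2; lra.
have egc : `|eg| <= c.
  have := lipg y (y + 1); have := lipg y (y - 1).
  rewrite (_ : y - (y - 1) = 1); last by ring.
  rewrite (_ : y - (y + 1) = - 1); last by ring.
  rewrite /eg BE normrN normr1 !ler_norml => /andP[? ?] /andP[? ?].
  by apply/andP; split; lra.
have uvE s : s \in ends l -> uv s = A + ell s * dv + z s * ev.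
  move=> _; rewrite /uv /z /dv /ev; have := AE.
  case: (cases s) => [[-> ->]|[[-> ->]|[-> ->]]]; rewrite /= ?addn0 ?addn1 ?addr0;
    by lra.
have ugE s : s \in ends l -> ug s = B + ell s * dg + z s * eg.
  move=> _; rewrite /ug /z /dg /eg; have := BE.
  by case: (cases s) => [[-> ->]|[[-> ->]|[-> ->]]]; rewrite /= ?addr0; lra.
have uvc s : s \in ends l -> `|uv s - A| <= c.
  move=> sl; rewrite uvE// /z.
  by case: (cases s) => [[-> ->]|[[-> ->]|[-> ->]]] /=; rewrite ?mul0r ?mul1r ?addr0
    ?mulN1r addrAC subrr add0r ?normrN.
have ugc s : s \in ends l -> `|ug s - B| <= c.
  move=> sl; rewrite ugE// /z.
  by case: (cases s) => [[-> ->]|[[-> ->]|[-> ->]]] /=; rewrite ?mul0r ?mul1r ?addr0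
    ?mulN1r addrAC subrr add0r ?normrN.
have z0 s : 0 <= z s by [].
have Sell : \sum_(s <- ends l) ell s = v + y.
  by rewrite sum_ends /ell aj nth_default// addr0 -(inv_vol inv).
have Sz : \sum_(s <- ends l) z s <= 2 * m%:R.
  rewrite sum_ends /z aj leqnn.
  have -> : \sum_(k < size l)
     ((j <= k %/ m)%:R + (j <= nth 0%N l k %/ m)%:R) = (pos st)%:R + w%:R :> R.
    rewrite -(inv_esum_loops inv) -(inv_esum_pos inv) /esum -big_split /=.
    apply: eq_bigr => k _; rewrite -/j.
    have kj : (k %/ m <= j)%N.
      by rewrite -aj leq_div2r// ltnW.
    have lk : (nth 0%N l k %/ m <= k %/ m)%N by rewrite leq_div2r// valid_nth.
    rewrite !(eqn_leq _ j) kj (leq_trans lk kj) /=; congr (_%:R + _%:R).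
  have : (w%:R : R) <= (pos st)%:R by rewrite ler_nat.
  have : ((pos st)%:R + 1 : R) <= m%:R by rewrite natr1 ler_nat.
  rewrite /=; lra.
have M0 : (0 : R) < (2 * size l + 1)%:R by rewrite ltr0n addn1.
have Hv := sum_sqr_drift uvE uvc dvc evc z0.
have Hg := sum_sqr_drift ugE ugc dgc egc z0.
rewrite /attach_mean size_ends in Hv Hg *.
rewrite ler_pdivrMr//.
have sumQ : \sum_(s <- ends l) potential (run (rcons l s)) <=
   \sum_(s <- ends l) uv s ^+ 2 + \sum_(s <- ends l) ug s ^+ 2
   + (2 * size l + 1)%:R * m%:R ^+ 2.
  rewrite mulr_natl -size_ends -[size (ends l)]count_predT -[_ *+ _]addr0.
  rewrite -iter_addr -big_const_seq -!big_split /=.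
  by apply: ler_sum => s _; exact: step.
apply: (le_trans sumQ); rewrite potE.
rewrite Sell in Hv Hg.
have near := vol_forecast_near r.+1 v y wm.
rewrite -/A in near.
have vyA : `|v + y| <= `|A| + 2 * m%:R.
  rewrite -[v + y](subrK A) (le_trans (ler_normD _ _))// addrC lerD2l.
  by rewrite distrC.
rewrite -!(real_normK (num_real A)) -!(real_normK (num_real B)) in Hv Hg *.
move: (normr_ge0 A) (normr_ge0 B) vyA Hv Hg; move: `|A| `|B| `|v + y| => a b p a0 b0 pa Hv Hg.
set M := (2 * size l + 1)%:R in M0 Hv Hg *.
set Z := \sum_(s <- _) z s in Sz Hv Hg *.
set SV := \sum_(s <- _) _ in Hv *; set SG := \sum_(s <- _) _ in Hg *.
have -> : ((1 + drift_const / M) * (a ^+ 2 + b ^+ 2) + drift_const) * M =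
   M * (a ^+ 2 + b ^+ 2 + drift_const) + drift_const * (a ^+ 2 + b ^+ 2).
  by field; rewrite gt_eqF.
have bound : 2 * c * (a + b) * (p + Z) <= drift_const * (a ^+ 2 + b ^+ 2) + 160 * m%:R ^+ 3.
  have -> : 2 * c * (a + b) * (p + Z) = 10 * m%:R * ((a + b) * (p + Z)).
    by rewrite /c; ring.
  (* (a + b) (a + k) <= 2 (a ^ 2 + b ^ 2) + k ^ 2, with k = 4 m *)
  have pZ : (a + b) * (p + Z) <= (a + b) * (a + 4 * m%:R).
    by apply: ler_wpM2l; [rewrite addr_ge0|lra].
  have sq : (a + b) * (a + 4 * m%:R) <= 2 * (a ^+ 2 + b ^+ 2) + 16 * m%:R ^+ 2.
    by have := sqr_ge0 (a - b); have := sqr_ge0 (a - 4 * m%:R);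
      have := sqr_ge0 (b - 4 * m%:R); have := sqr_ge0 b; lra.
  have m10 : (0 : R) <= 10 * m%:R by rewrite mulr_ge0.
  apply: (le_trans (ler_wpM2l m10 (le_trans pZ sq))).
  have ab0 : 0 <= a ^+ 2 + b ^+ 2 by rewrite addr_ge0 ?sqr_ge0.
  have : 20 * m%:R * (a ^+ 2 + b ^+ 2) <= drift_const * (a ^+ 2 + b ^+ 2).
    apply: ler_wpM2r => //; rewrite /drift_const.
    have : m%:R <= m%:R ^+ 3 :> R by rewrite -[leLHS]expr1 ler_weXn2l.
    lra.
  lra.
have c2 : 2 * c ^+ 2 + m%:R ^+ 2 <= 51 * m%:R ^+ 3.
  rewrite /c (_ : 2 * _ + _ = 51 * m%:R ^+ 2); last by ring.
  by rewrite ler_pM2l// ler_weXn2l.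
have M1 : 1 <= M by rewrite /M ler1n addn1.
have m3M : 160 * m%:R ^+ 3 <= M * (160 * m%:R ^+ 3).
  by rewrite ler_peMl// mulr_ge0// exprn_ge0.
have c2M := ler_wpM2l (ltW M0) c2.
rewrite /drift_const in bound *; lra.
Qed.

End Potential.

(** * Second moment of the potential *)

Section SecondMoment.
Variables (R : realType) (m j0 : nat).
Hypothesis m_gt0 : (0 < m)%N.
Local Notation pot := (fun l => potential m (run m j0 (mean_abs R m) l)).

Lemma drift_const_ge0 : 0 <= drift_const R m.
Proof. by rewrite /drift_const mulr_ge0// exprn_ge0. Qed.

Lemma potential_burn_in l : valid l -> size l = (m * j0)%N ->
  pot l <= 5 * m%:R ^+ 2.
Proof.
move=> vl sl; have [inv pm] := run_inv j0 (mean_abs R m) m_gt0 vl.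
set st := run _ _ _ _ in inv pm *.
have sz := inv_size inv.
have jE : size (lab st) = j0.
  by have := congr1 (divn^~ m) sz; rewrite sl divnMDl// mulKn// divn_small// addn0.
have p0 : pos st = 0%N.
  by move: sz; rewrite sl jE mulnC -[X in X = _]addn0 => /addnI.
have w0 : loops st = 0%N by apply/eqP; rewrite -leqn0 -p0 (inv_loops inv).
have y0 : ysum st = 0.
  by apply/eqP; rewrite -normr_le0 (le_trans (inv_ysum inv))// p0 w0 subrr.
have [vb g0] : `|vol st| <= 2 * m%:R /\ gain st = 0.
  by apply: (inv_burn inv); rewrite jE.
rewrite /potential p0 w0 y0 subn0 gain_forecast_start g0 expr0n addr0.
apply: (le_trans (vol_forecast_start _ _)).
have : vol st ^+ 2 <= (2 * m%:R) ^+ 2.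
  by rewrite -real_normK ?num_real// lerXn2r ?nnegrE ?mulr_ge0.
lra.
Qed.

(** A discrete Gronwall inequality, started at the end of the balancing phase, where
    the potential is bounded for every outcome. *)
Lemma pa_mean_potential (K : R) s : drift_const R m / (2 * (m * j0) + 1)%:R <= K ->
  pa_mean (m * j0 + s) pot <= (5 * m%:R ^+ 2 + s%:R * drift_const R m) * (1 + K) ^+ s.
Proof.
move=> Kge; have k0 := drift_const_ge0.
have K0 : 0 <= K by apply: le_trans Kge; rewrite divr_ge0.
have m20 : (0 : R) <= 5 * m%:R ^+ 2 by rewrite mulr_ge0// exprn_ge0.
elim: s => [|s IHs].
  rewrite addn0 mul0r addr0 expr0 mulr1 -[leRHS](pa_mean_cst (m * j0)).
  by apply: le_pa_mean => l sl vl; exact: potential_burn_in.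
rewrite addnS /=.
have step : pa_mean (m * j0 + s) (attach_mean pot) <=
    (1 + K) * pa_mean (m * j0 + s) pot + drift_const R m.
  rewrite -pa_mean_affine; apply: le_pa_mean => l sl vl.
  apply: (le_trans (attach_mean_potential R m_gt0 vl _)); first by rewrite sl leq_addr.
  rewrite lerD2r ler_wpM2r ?addr_ge0 ?sqr_ge0// lerD2l.
  apply: le_trans Kge; rewrite ler_wpM2l// lef_pV2 ?posrE ?ltr0n ?addn1//.
  by rewrite ler_nat ltnS leq_mul2l/= sl leq_addr.
apply: (le_trans step).
have K1 : 1 <= (1 + K) ^+ s.+1 by rewrite exprn_ege1// lerDl.
apply: (@le_trans _ _ ((1 + K) * ((5 * m%:R ^+ 2 + s%:R * drift_const R m) * (1 + K) ^+ s)
    + drift_const R m)).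
  by rewrite lerD2r ler_wpM2l// addr_ge0.
rewrite mulrCA -exprS (_ : s.+1%:R = s%:R + 1 :> R); last by rewrite natr1.
rewrite [(s%:R + 1) * _]mulrDl mul1r addrA [leRHS]mulrDl lerD2l.
by rewrite ler_peMr.
Qed.

End SecondMoment.

(** After the first n / q vertices every factor is at most 1 + K with K of order
    1 / (n m), so their product stays below a constant that depends on m and q only. *)
Lemma pa_mean_potential_final (R : realType) (m n q : nat) :
  (0 < m)%N -> (0 < n)%N -> (0 < q)%N ->
  pa_mean (n * m) (fun l => potential m (run m (n %/ q) (mean_abs R m) l)) <=
  (5 * m%:R ^+ 2 + (n * m)%:R * drift_const R m) * expR (drift_const R m * (q * m)%:R).
Proof.
move=> m0 n0 q0; set j0 := (n %/ q)%N; set N := (n * m)%N.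
have N0 : (0 < N)%N by rewrite muln_gt0 n0.
have j0n : (m * j0 <= N)%N by rewrite /N mulnC leq_mul2r leq_div orbT.
have k0 := drift_const_ge0 R m.
set K := drift_const R m * (q * m)%:R / N%:R.
have K0 : 0 <= K by rewrite /K divr_ge0 ?mulr_ge0.
set s := (N - m * j0)%N; have Ns : N = (m * j0 + s)%N by rewrite subnKC.
have sN : (s <= N)%N by exact: leq_subr.
rewrite [X in pa_mean X]Ns; apply: (le_trans (@pa_mean_potential _ _ _ m0 K s _)).
  rewrite /K -mulrA ler_wpM2l// ler_pdivlMr ?ltr0n// mulrC ler_pdivrMr ?ltr0n ?addn1//.
  rewrite -natrM ler_nat.
  have : (n < j0.+1 * q)%N by rewrite /j0 -ltn_divLR.
  rewrite /N; nia.
apply: ler_pM.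
- by rewrite addr_ge0// mulr_ge0// exprn_ge0.
- by rewrite exprn_ge0// addr_ge0.
- by rewrite lerD2l ler_wpM2r// ler_nat.
apply: (@le_trans _ _ ((1 + K) ^+ N)); first by rewrite ler_weXn2l// lerDl.
apply: (@le_trans _ _ (expR K ^+ N)).
  by rewrite lerXn2r ?nnegrE ?expR_ge0 ?addr_ge0// expR_ge1Dx.
by rewrite -expRM_natl /K -mulr_natl mulrCA divff ?mulr1// pnatr_eq0 -lt0n.
Qed.

(** * From the law of the choices to lists of targets *)

Section Codes.
Variables (R : realType).

Definition codes (N M : nat) (x : {ffun 'I_N -> 'I_M}) : seq nat :=
  [seq val (x i) | i <- enum 'I_N].

(** The attachment probability, as a function of the list of earlier targets. *)
Definition attach_weight (l : seq nat) (s : nat) : R :=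
  if (s < size l)%N then (1 + count_mem s l)%:R / (2 * size l + 1)%:R
  else if s == size l then 1 / (2 * size l + 1)%:R else 0.

Lemma size_codes N M (x : {ffun 'I_N -> 'I_M}) : size (codes x) = N.
Proof. by rewrite size_map size_enum_ord. Qed.

Lemma nth_codes N M (x : {ffun 'I_N -> 'I_M}) (i : 'I_N) : nth 0%N (codes x) i = x i.
Proof. by rewrite (nth_map i) ?size_enum_ord// nth_ord_enum. Qed.

Lemma sum_count_mem M (r : seq nat) (f : nat -> R) : all (fun s => (s < M)%N) r ->
  \sum_(s < M) (count_mem (val s) r)%:R * f s = \sum_(s <- r) f s.
Proof.
elim: r => [_|a r IHr /= /andP[aM rM]].
  by rewrite big_nil big1// => s _; rewrite mul0r.
rewrite big_cons -IHr//.
under eq_bigr do rewrite natrD mulrDl.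
rewrite big_split /=; congr (_ + _).
rewrite (bigD1 (Ordinal aM))//= eqxx mul1r big1 ?addr0// => s sa.
by rewrite eq_sym (negPf (_ : val s != a)) ?mul0r// -[a]/(val (Ordinal aM)) (inj_eq val_inj).
Qed.

Lemma sum_attach_weight M l (F : seq nat -> R) : valid l -> (size l < M)%N ->
  \sum_(s < M) attach_weight l s * F (rcons l s) = attach_mean F l.
Proof.
move=> vl lM; rewrite /attach_mean mulr_suml.
rewrite -(@sum_count_mem M _ (fun s => F (rcons l s) / (size (ends l))%:R)); last first.
  by apply/allP => s sl; apply: leq_ltn_trans lM; exact: valid_ends sl.
apply: eq_bigr => s _; rewrite [RHS]mulrA [RHS]mulrAC; congr (_ * _).
have lls : (size l <= s)%N -> count_mem (val s) l = 0%N.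
  move=> ls; apply/count_memPn/negP => /(nthP 0%N)[k kl sE].
  by have := valid_nth k vl; rewrite sE => /(leq_trans ls); rewrite leqNgt kl.
rewrite size_ends /attach_weight count_cat (count_uniq_mem _ (iota_uniq _ _)).
rewrite mem_iota add0n ltnS.
case: ltngtP => //= sl; first by rewrite lls 1?ltnW// mul0r.
by rewrite lls ?sl.
Qed.

(** The codomain is kept apart from the domain so that the last choice can be split
    off by induction on N alone. *)
Lemma sum_chain M N (F : seq nat -> R) : (N <= M)%N ->
  \sum_(x : {ffun 'I_N -> 'I_M})
     (\prod_(t < N) attach_weight (take t (codes x)) (x t)) * F (codes x)
  = pa_mean N F.
Proof.
elim: N F => [|N IHN] F NM.
  have codes0 (x : {ffun 'I_0 -> 'I_M}) : codes x = [::].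
    by apply: size0nil; rewrite size_codes.
  under eq_bigr do rewrite big_ord0 mul1r codes0.
  by rewrite sumr_const card_ffun !card_ord expn0.
pose ext (p : {ffun 'I_N -> 'I_M} * 'I_M) : {ffun 'I_N.+1 -> 'I_M} :=
  [ffun i => if unlift ord_max i is Some j then p.1 j else p.2].
pose cut (x : {ffun 'I_N.+1 -> 'I_M}) : {ffun 'I_N -> 'I_M} * 'I_M :=
  ([ffun j => x (widen_ord (leqnSn N) j)], x ord_max).
have wE (j : 'I_N) : widen_ord (leqnSn N) j = lift ord_max j.
  by apply: ord_inj; rewrite lift_max.
have codesE p : codes (ext p) = rcons (codes p.1) (p.2 : nat).
  rewrite /codes enum_ordSr map_rcons -map_comp; congr rcons.
    by apply: eq_map => j /=; rewrite wE ffunE liftK.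
  by rewrite ffunE unlift_none.
rewrite (reindex ext); last first.
  exists cut => [[x s] _|x _].
    rewrite /cut ffunE unlift_none; congr (_, _).
    by apply/ffunP => j; rewrite ffunE wE ffunE liftK.
  apply/ffunP => i; rewrite ffunE; case: unliftP => [j ->|->] //=.
  by rewrite ffunE wE.
have -> : pa_mean N.+1 F =
    pa_mean N (fun l => \sum_(s < M) attach_weight l s * F (rcons l s)).
  by rewrite /=; apply: eq_pa_mean => l lN vl; rewrite -(@sum_attach_weight M)// lN.
rewrite -IHN ?(ltnW NM)//.
rewrite -(pair_big xpredT xpredT (fun x s => (\prod_(t < N.+1)
   attach_weight (take t (codes (ext (x, s)))) (ext (x, s) t)) * F (codes (ext (x, s))))) /=.
apply: eq_bigr => x _; rewrite mulr_sumr; apply: eq_bigr => s _.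
rewrite mulrA codesE /=; congr (_ * _).
rewrite big_ord_recr /= -cats1 take_size_cat ?size_codes// ffunE unlift_none.
congr (_ * _); apply: eq_bigr => t _.
by rewrite wE ffunE liftK take_cat size_codes ltn_ord.
Qed.

Lemma attach_probE N (x : {ffun 'I_N -> 'I_N}) (t s : 'I_N) :
  attach_prob R x t s = attach_weight (take t (codes x)) s.
Proof.
have st : size (take t (codes x)) = t by rewrite size_takel// size_codes ltnW.
rewrite /attach_prob /attach_weight st; case: ifP => // lt_st.
have tN : (t <= N)%N by exact: ltnW.
congr (_%:R / _); rewrite /deg /pa_graph1 big_map big_filter big_split /=.
rewrite !big_enum_cond /=; congr addn.
  rewrite (bigD1 s)//= eqxx big1 ?addn0// => j /andP[_ /negPf].
  by move=> ->.
rewrite (eq_bigr (fun j : 'I_N => (nth 0%N (codes x) j == s) : nat)); last first.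
  by move=> j _; rewrite nth_codes.
rewrite -(big_ord_widen N (fun j => (nth 0%N (codes x) j == s) : nat) tN).
rewrite -sum1_count (big_nth 0%N) big_mkord st [RHS]big_mkcond.
by apply: eq_bigr => j _; rewrite nth_take//=; case: eqP.
Qed.

Lemma pa_lawE N (x : {ffun 'I_N -> 'I_N}) :
  pa_law R x = \prod_(t < N) attach_weight (take t (codes x)) (x t).
Proof. by apply: eq_bigr => t _; exact: attach_probE. Qed.

Lemma sum_pa_law N (F : seq nat -> R) :
  \sum_(x : {ffun 'I_N -> 'I_N}) pa_law R x * F (codes x) = pa_mean N F.
Proof.
by rewrite -(@sum_chain N)//; apply: eq_bigr => x _; rewrite pa_lawE.
Qed.

Lemma pa_law_ge0 N (x : {ffun 'I_N -> 'I_N}) : 0 <= pa_law R x.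
Proof.
apply: prodr_ge0 => t _; rewrite /attach_prob.
by case: ifP => _; [|case: ifP => _//]; rewrite divr_ge0.
Qed.

Lemma pa_prob_le1 m n (E : mgraph 'I_n -> bool) : pa_prob R m E <= 1.
Proof.
rewrite -[leRHS](pa_mean_cst (n * m)) -sum_pa_law /pa_prob big_mkcond /=.
apply: ler_sum => x _; rewrite mulr1.
by case: ifP => _ //; exact: pa_law_ge0.
Qed.

(** Markov's inequality. *)
Lemma pa_prob_ge m n (E : mgraph 'I_n -> bool) (Q : seq nat -> R) (b : R) :
  0 < b -> (forall l, 0 <= Q l) ->
  (forall x : {ffun 'I_(n * m) -> 'I_(n * m)},
     valid (codes x) -> Q (codes x) <= b -> E (pa_graph x)) ->
  1 - pa_mean (n * m) Q / b <= pa_prob R m E.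
Proof.
move=> b0 Q0 QE; pose F l : R := (valid l && (Q l <= b))%:R.
have F0 l : 0 <= F l by [].
apply: (@le_trans _ _ (pa_mean (n * m) F)).
  have -> : 1 - pa_mean (n * m) Q / b = pa_mean (n * m) (fun l => - b^-1 * Q l + 1).
    by rewrite pa_mean_affine; ring.
  apply: le_pa_mean => l _ vl; rewrite /F vl /= mulNr.
  case: (leP (Q l) b) => [Qb|bQ] /=.
    have : 0 <= b^-1 * Q l by rewrite mulr_ge0// invr_ge0 ltW.
    by lra.
  by rewrite addrC subr_le0 mulrC ler_pdivlMr// mul1r ltW.
rewrite -sum_pa_law /pa_prob [leRHS]big_mkcond /=.
apply: ler_sum => x _; rewrite /F; case: (boolP (valid _ && _)) => [/andP[vx Qx]|_].
  by rewrite QE// mulr1.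
by rewrite mulr0; case: ifP => _ //; exact: pa_law_ge0.
Qed.

End Codes.

(** * Modularity of a bipartition *)

Section Bipartition.
Variables (R : realType) (V : finType).
Implicit Types (G : mgraph V) (A : {set V}) (P : {set {set V}}).

Lemma modularity_ge G P (v0 : V) : finset.partition P [set: V] ->
  modularity_of R G P <= modularity R G.
Proof.
move=> Ppart; rewrite /modularity.
have P1 : finset.partition [set [set: V]] [set: V].
  apply/and3P; split.
  - by rewrite /finset.cover big_set1.
  - by apply/finset.trivIsetP => A B; rewrite !inE => /eqP-> /eqP->; rewrite eqxx.
  - by rewrite inE eq_sym; apply/set0Pn; exists v0; rewrite inE.
by case: Order.TotalTheory.arg_maxP => // Q _; exact.
Qed.

(** Removing the empty set accounts for the case where one of the blocks is empty. *)
Lemma two_block_partition A :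
  finset.partition ([set A; ~: A] :\ finset.set0) [set: V].
Proof.
apply/and3P; split.
- apply/eqP/setP => v; rewrite inE; apply/bigcupP.
  have [vA|vA] := boolP (v \in A).
    by exists A => //; rewrite !inE eqxx andbT; apply/set0Pn; exists v.
  exists (~: A); last by rewrite inE.
  by rewrite !inE eqxx orbT andbT; apply/set0Pn; exists v; rewrite inE.
- apply/finset.trivIsetP => B C; rewrite !inE => /andP[_ BA] /andP[_ CA].
  have Ad : [disjoint A & ~: A] by rewrite -setI_eq0 finset.setICr.
  move: BA CA => /orP[]/eqP-> /orP[]/eqP->; rewrite ?eqxx// => _.
  by rewrite disjoint_sym.
- by rewrite !inE eqxx.
Qed.

(** With N edges and signed volume S, the number of internal edges is (N + Y) / 2,
    Y being the sum of the products of labels, and the volumes of the blocks are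
    N + S / 2 and N - S / 2; the terms 1/2 cancel. *)
Lemma modularity_ge_bipartition G (c : V -> R) : (0 < size G)%N ->
  (forall v, c v = 1 \/ c v = -1) ->
  (\sum_(e <- G) c e.1 * c e.2) / (2 * (size G)%:R)
    - (\sum_(e <- G) (c e.1 + c e.2)) ^+ 2 / (8 * (size G)%:R ^+ 2)
  <= modularity R G.
Proof.
move=> G0 c1; have [v0 _] : exists v0 : V, True.
  by case: G G0 => // -[v w] ? _; exists v.
pose A := [set v | c v == 1]; set N : R := (size G)%:R.
have N0 : 0 < N by rewrite ltr0n.
have inA v : (v \in A)%:R = (1 + c v) / 2 :> R.
  rewrite inE; case: (c1 v) => ->; rewrite ?eqxx /=; first by field.
  by rewrite (_ : (-1 == 1 :> R) = false) /=; [field|apply/eqP; lra].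
have inC v : (v \in ~: A)%:R = (1 - c v) / 2 :> R.
  have -> : (v \in ~: A)%:R = 1 - (v \in A)%:R :> R.
    by rewrite inE; case: (v \in A) => /=; rewrite ?subrr ?subr0.
  by rewrite inA; field.
have sum1 : \sum_(e <- G) (1 : R) = N.
  by rewrite big_const_seq iter_addr addr0 count_predT.
have volE (B : {set V}) : ((\sum_(v in B) deg G v)%N)%:R
    = \sum_(e <- G) ((e.1 \in B)%:R + (e.2 \in B)%:R) :> R.
  rewrite exchange_big /= natr_sum; apply: eq_bigr => e _.
  rewrite big_split /= natrD.
  have cnt (v : V) : (\sum_(w in B) (v == w))%N = (v \in B).
    have [vB|vB] := boolP (v \in B).
      rewrite (bigD1 v)//= eqxx big1 ?addn0// => w /andP[_ /negPf].
      by rewrite eq_sym => ->.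
    by rewrite big1// => w wB; case: eqP => // vw; rewrite vw wB in vB.
  by rewrite !cnt.
have inE' (B : {set V}) : (edges_within G B)%:R
    = \sum_(e <- G) (e.1 \in B)%:R * (e.2 \in B)%:R :> R.
  rewrite /edges_within -sum1_count big_mkcond natr_sum; apply: eq_bigr => e _.
  by case: (e.1 \in B); case: (e.2 \in B); rewrite /= ?mulr0 ?mul0r ?mulr1.
apply: le_trans (modularity_ge G v0 (two_block_partition A)).
set Y := \sum_(e <- G) _; set S := \sum_(e <- G) _.
have AnC : A \notin [set ~: A].
  rewrite inE; apply/eqP => /setP/(_ v0); rewrite !inE; by case: (_ == _).
rewrite /modularity_of.
have term0 : (edges_within G finset.set0)%:R / N
   - ((\sum_(v in finset.set0) deg G v)%N)%:R ^+ 2 / (4 * N ^+ 2) = 0.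
  rewrite big_set0 expr0n mul0r subr0 inE' big1 ?mul0r// => e _.
  by rewrite inE mul0r.
set P := [set A; _]; set F := fun B : {set V} => (edges_within G B)%:R / N
   - ((\sum_(v in B) deg G v)%N)%:R ^+ 2 / (4 * N ^+ 2) in term0 *.
have -> : \sum_(B in P :\ finset.set0) F B = \sum_(B in P) F B.
  have [P0|P0] := boolP (finset.set0 \in P).
    by rewrite [RHS](big_setD1 _ P0) /= /F term0 add0r.
  apply: eq_bigl => B; rewrite !inE andb_idl// => BP.
  by apply: contraNneq P0 => <-; rewrite !inE.
rewrite /P big_setU1//= big_set1 /F !volE !inE'.
have -> : \sum_(e <- G) (e.1 \in ~: A)%:R * (e.2 \in ~: A)%:R
  = N / 2 + Y / 2 - \sum_(e <- G) (e.1 \in A)%:R * (e.2 \in A)%:R :> R.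
  rewrite -sum1 !mulr_suml -sumrN -!big_split /=; apply: eq_bigr => e _.
  by rewrite !inA !inC; field.
have -> : \sum_(e <- G) ((e.1 \in A)%:R + (e.2 \in A)%:R) = N + S / 2 :> R.
  rewrite -sum1 !mulr_suml -!big_split /=; apply: eq_bigr => e _.
  by rewrite !inA; field.
have -> : \sum_(e <- G) ((e.1 \in ~: A)%:R + (e.2 \in ~: A)%:R) = N - S / 2 :> R.
  rewrite -sum1 !mulr_suml -sumrN -!big_split /=; apply: eq_bigr => e _.
  by rewrite !inC; field.
set Z := \sum_(e <- G) _ * _.
rewrite le_eqVlt; apply/orP; left; apply/eqP; field.
by rewrite gt_eqF.
Qed.

End Bipartition.

(** * The mean deviation of the binomial law *)

Section Binomial.
Variable R : realType.

Lemma binomial_mean_devE m : binomial_mean_dev R m = mean_abs R m / 2.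
Proof.
rewrite /binomial_mean_dev unlock.
have p0 : (0 : R) <= 2^-1 by [].
have p1 : (NngNum p0)%:num <= 1 :> R by rewrite /= invf_le1// ler1n.
rewrite (integral_binomial _ p1) /=; last by move=> k; rewrite lee_fin.
under eq_bigr do rewrite -EFinM.
rewrite sumEFin /= /mean_abs coin_meanE mulr_suml.
apply: eq_bigr => k _.
rewrite /= /unstable.onem (_ : 1 - 2^-1 = 2^-1 :> R); last by field.
rewrite -exprD subnKC -1?ltnS// -[_ *+ 'C(_, _)]mulr_natl exprVn.
have -> : 0 + k%:R * 2 - m%:R = 2 * (k%:R - m%:R / 2) :> R by field.
rewrite normrM normr_nat; field.
by rewrite expf_neq0.
Qed.

(** |x| = 2 max(x, 0) - x, and the sum of signs has mean 0. *)
Lemma mean_abs_pos_part m :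
  mean_abs R m = 2 * coin_mean m (fun x : R => Num.max x 0) 0.
Proof.
have H x : `|x| = 2 * Num.max x 0 + (-1) * x :> R.
  by case: (lerP x 0) => x0; [rewrite ler0_norm//|rewrite gtr0_norm//]; ring.
rewrite /mean_abs (eq_coin_mean _ H) coin_mean_comb coin_mean_id.
by rewrite mulr0 addr0.
Qed.

(** Only the terms with more than m / 2 successes survive in the positive part, whence
    one formula for both parities. *)
Lemma mean_absE m : mean_abs R m / (2 * m%:R) =
  (2 : R) ^ (1 - m%:Z) / m%:R *
  \sum_(1 <= i < (m.+1 - m./2)) (i%:R + (m./2)%:R - m%:R / 2) * 'C(m, m./2 + i)%:R.
Proof.
have hm : (m./2 < m.+1)%N by lia.
rewrite mean_abs_pos_part coin_meanE.
rewrite -(big_mkord xpredT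
  (fun k => 'C(m, k)%:R / 2 ^+ m * Num.max (0 + k%:R * 2 - m%:R) 0)).
rewrite (big_cat_nat _ (n := (m./2).+1))//= big1_seq ?add0r; last first.
  move=> k /=; rewrite mem_index_iota => /andP[_ kh].
  rewrite (_ : Num.max _ _ = 0) ?mulr0//; apply/max_idPr.
  rewrite add0r subr_le0 -natrM ler_nat; lia.
rewrite -[(m./2).+1]add1n big_addn.
have -> : (2 : R) ^ (1 - m%:Z) = 2 / 2 ^+ m.
  rewrite expfzDr//.
  by rewrite expr1z exprnN.
set S := \sum_(1 <= i < _) (_ - _) * _.
have -> : \sum_(1 <= i < m.+1 - m./2)
    'C(m, i + m./2)%:R / 2 ^+ m * Num.max (0 + (i + m./2)%:R * 2 - m%:R) 0
    = 2 / 2 ^+ m * S.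
  rewrite /S mulr_sumr; apply: eq_big_nat => i /andP[i1 _].
  rewrite add0r (_ : Num.max _ _ = (i + m./2)%:R * 2 - m%:R); last first.
    by apply/max_idPl; rewrite subr_ge0 -natrM ler_nat; lia.
  by rewrite natrD [(i + _)%N]addnC; move: (2 ^- m) => ?; field.
by rewrite invfM; move: (2 ^- m) (m%:R^-1) => ? ?; field.
Qed.

End Binomial.

(** * Lower bounds holding with high probability *)

Section Assembly.
Variable R : realType.

Lemma mean_abs_le m : mean_abs R m <= m%:R.
Proof.
rewrite /mean_abs -[leRHS]add0r -[X in _ <= X + _](normr0 R).
elim: m 0 => [|r IHr] y /=; first by rewrite addr0.
rewrite (_ : r.+1%:R = r%:R + 1 :> R) ?natr1//; have := IHr (y + 1); have := IHr (y - 1).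
have := ler_normD y 1; have := ler_normB y 1; rewrite normr1.
lra.
Qed.

Lemma sum_gain_target m n j0 (mu : R) : (j0 <= n)%N ->
  \sum_(i < n) (if (i < j0)%N then - m%:R else mu)
    = n%:R * mu - (m%:R + mu) * j0%:R.
Proof.
move=> j0n.
have -> : (j0%:R : R) = \sum_(i < n) (if (i < j0)%N then 1 else 0).
  by rewrite -big_mkcond -(big_ord_widen n (fun=> 1) j0n) sumr_const card_ord.
rewrite mulr_sumr -[n in n%:R * mu]card_ord mulr_natl -sumr_const -sumrB.
by apply: eq_bigr => i _; case: ifP => _; ring.
Qed.

Lemma size_pa_graph m n (x : {ffun 'I_(n * m) -> 'I_(n * m)}) :
  size (pa_graph x) = (n * m)%N.
Proof.
rewrite /pa_graph /identify /pa_graph1 !size_map size_filter.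
rewrite (eq_count (a2 := predT)) ?count_predT ?size_enum_ord// => j /=.
exact: ltn_ord.
Qed.

Lemma sum_pa_graph m n (x : {ffun 'I_(n * m) -> 'I_(n * m)}) (F : nat -> nat -> R) :
  \sum_(e <- pa_graph x) F e.1 e.2 = esum m (codes x) F.
Proof.
rewrite /pa_graph /identify /pa_graph1 !big_map big_filter /esum big_enum_cond /=.
rewrite size_codes; apply: eq_big => [k|k _]; first by rewrite ltn_ord.
by rewrite nth_codes.
Qed.

(** The loss 2 / q collects the balancing phase (1 / q), the deviation of gain
    (1 / 2q) and the squared signed volume (at most 1 / 2q). *)
Lemma modularity_pa_graph_ge m n q (x : {ffun 'I_(n * m) -> 'I_(n * m)}) :
  (0 < m)%N -> (0 < n)%N -> (0 < q)%N -> (2 * q <= n)%N -> valid (codes x) ->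
  potential m (run m (n %/ q) (mean_abs R m) (codes x)) <= ((n * m)%:R / q%:R) ^+ 2 ->
  mean_abs R m / (2 * m%:R) - 2 / q%:R <= modularity R (pa_graph x).
Proof.
move=> m0 n0 q0 qn vx; set j0 := (n %/ q)%N; set mu := mean_abs R m.
have [inv pm] := run_inv j0 mu m0 vx.
set st := run _ _ _ _ in inv pm *; set N : R := (n * m)%:R => potle.
have N0 : 0 < N by rewrite ltr0n muln_gt0 n0.
have Q0 : (0 : R) < q%:R by rewrite ltr0n.
have M0 : (0 : R) < m%:R by rewrite ltr0n.
have n0' : (0 : R) < n%:R by rewrite ltr0n.
have sz := inv_size inv; rewrite size_codes in sz.
have labn : size (lab st) = n.
  by have := congr1 (divn^~ m) sz; rewrite mulnK// divnMDl// divn_small// addn0.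
have p0 : pos st = 0%N by move: sz; rewrite labn -[X in X = _]addn0 => /addnI.
have w0 : loops st = 0%N by apply/eqP; rewrite -leqn0 -p0 (inv_loops inv).
have y0 : ysum st = 0.
  by apply/eqP; rewrite -normr_le0 (le_trans (inv_ysum inv))// p0 w0 subrr.
have Nq0 : 0 <= N / q%:R by rewrite divr_ge0// ltW.
have sqr_le (a b : R) : 0 <= b -> a ^+ 2 <= b ^+ 2 -> `|a| <= b.
  by move=> b0; rewrite -[a ^+ 2](real_normK (num_real a)) ler_sqr ?nnegrE.
move: potle; rewrite /potential p0 w0 y0 subn0 gain_forecast_start => potle.
have gainb : `|gain st| <= N / q%:R.
  by apply: sqr_le => //; apply: le_trans potle; rewrite lerDr sqr_ge0.
have volb : `|vol st| <= 2 * (N / q%:R).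
  have : `|vol_forecast m m (vol st) 0 0| <= N / q%:R.
    by apply: sqr_le => //; apply: le_trans potle; rewrite lerDl sqr_ge0.
  have := vol_forecast_near m (vol st) 0 (leq0n m); rewrite addr0.
  have : 2 * m%:R <= N / q%:R.
    by rewrite ler_pdivlMr// -!natrM ler_nat mulnAC leq_mul2r qn orbT.
  rewrite !ler_norml => ? /andP[? ?] /andP[? ?].
  by apply/andP; split; lra.
pose c (v : 'I_n) : R := (lab st)`_v.
have c1 v : c v = 1 \/ c v = -1 by apply: (inv_lab inv); rewrite labn.
have sG0 : (0 < size (pa_graph x))%N by rewrite size_pa_graph muln_gt0 n0.
apply: le_trans (modularity_ge_bipartition sG0 c1).
rewrite (sum_pa_graph x (fun a b => (lab st)`_a * (lab st)`_b)).
rewrite (sum_pa_graph x (fun a b => (lab st)`_a + (lab st)`_b)).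
rewrite size_pa_graph -/N (inv_vol inv) y0 addr0.
have := inv_gain inv; rewrite labn sum_gain_target ?leq_div//.
set Y := esum _ _ _ => Yge.
have muM : mu <= m%:R by exact: mean_abs_le.
have mu0 : 0 <= mu.
  by apply: le_trans (coin_mean_abs_ge R m); rewrite divr_ge0 ?sqrtr_ge0.
have jq : j0%:R <= n%:R / q%:R :> R.
  by rewrite ler_pdivlMr// -natrM ler_nat leq_divM.
have NE : N = n%:R * m%:R by rewrite /N natrM.
have volt : vol st ^+ 2 / (8 * N ^+ 2) <= (2 * q%:R)^-1.
  have v2 : vol st ^+ 2 <= (2 * (N / q%:R)) ^+ 2.
    by rewrite -[vol st ^+ 2](real_normK (num_real _)) ler_sqr ?nnegrE ?mulr_ge0.
  have N8 : 0 < 8 * N ^+ 2 by rewrite mulr_gt0// exprn_gt0.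
  rewrite ler_pdivrMr//; apply: (le_trans v2).
  have -> : (2 * q%:R)^-1 * (8 * N ^+ 2) = 4 * N ^+ 2 / q%:R by field; rewrite gt_eqF.
  have -> : (2 * (N / q%:R)) ^+ 2 = 4 * N ^+ 2 / q%:R * q%:R^-1 by field; rewrite gt_eqF.
  by rewrite ler_piMr ?mulr_ge0 ?exprn_ge0 ?invr_ge0 ?invf_le1 ?ler1n// ltW.
have gain1 : mu / (2 * m%:R) - 3 / (2 * q%:R) <= Y / (2 * N).
  rewrite ler_pdivlMr ?mulr_gt0//.
  have -> : (mu / (2 * m%:R) - 3 / (2 * q%:R)) * (2 * N) =
     n%:R * mu - 3 * (N / q%:R).
    by rewrite NE; field; rewrite !gt_eqF.
  have : (m%:R + mu) * j0%:R <= 2 * (N / q%:R).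
    rewrite (_ : 2 * (N / q%:R) = (m%:R + m%:R) * (n%:R / q%:R)); last first.
      by rewrite NE; field; rewrite gt_eqF.
    by apply: ler_pM => //; [rewrite addr_ge0// ltW|rewrite lerD2l].
  by move: gainb; rewrite ler_norml => /andP[? ?] ?; lra.
have -> : 2 / q%:R = 3 / (2 * q%:R) + (2 * q%:R)^-1 :> R by field; rewrite gt_eqF.
lra.
Qed.

(** The mean potential is O(n) for fixed q, while the threshold in
    modularity_pa_graph_ge is of order n ^ 2. *)
Lemma pa_prob_modularity_ge m q (d : R) : (0 < m)%N -> (0 < q)%N -> 0 < d ->
  (\forall n \near \oo, 1 - d <= pa_prob R m (fun G : mgraph 'I_n =>
     mean_abs R m / (2 * m%:R) - 2 / q%:R <= modularity R G))%classic.
Proof.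
move=> m0 q0 d0.
set C := (5 * m%:R ^+ 2 + drift_const R m) * expR (drift_const R m * (q * m)%:R) * q%:R ^+ 2.
have C0 : 0 <= C.
  rewrite /C !mulr_ge0 ?addr_ge0 ?mulr_ge0 ?exprn_ge0 ?expR_ge0//.
near=> n.
have n2 : (2 * q <= n)%N by near: n; exact: nbhs_infty_ge.
have n0 : (0 < n)%N by rewrite (leq_trans _ n2)// muln_gt0.
have nC : C / d <= n%:R by near: n; exact: nbhs_infty_ger.
have N0 : (0 : R) < (n * m)%:R by rewrite ltr0n muln_gt0 n0.
have N1 : (1 : R) <= (n * m)%:R by rewrite ler1n muln_gt0 n0.
have Q0 : (0 : R) < q%:R by rewrite ltr0n.
have b0 : 0 < ((n * m)%:R / q%:R) ^+ 2 :> R by rewrite exprn_gt0 ?divr_gt0.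
pose Q l := potential m (run m (n %/ q) (mean_abs R m) l).
apply: (le_trans _ (pa_prob_ge b0 (Q := Q) _ _)).
- rewrite lerD2l lerN2 ler_pdivrMr//.
  apply: (le_trans (pa_mean_potential_final R m0 n0 q0)).
  have k0 := drift_const_ge0 R m.
  set N := (n * m)%:R in N0 N1 b0 *.
  have CN : C / d <= N by rewrite (le_trans nC)// /N ler_nat leq_pmulr.
  have : C <= d * N by rewrite mulrC -ler_pdivrMr.
  have -> : d * (N / q%:R) ^+ 2 = d * N * N / q%:R ^+ 2 by field; rewrite gt_eqF.
  rewrite ler_pdivlMr ?exprn_gt0// => CdN.
  apply: (@le_trans _ _ (C * N)); last by rewrite ler_wpM2r// ltW.
  rewrite /C; set E := expR _; have E0 : 0 <= E * q%:R ^+ 2.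
    by rewrite mulr_ge0 ?expR_ge0 ?exprn_ge0.
  rewrite -[leLHS]mulrA.
  have -> : (5 * m%:R ^+ 2 + drift_const R m) * E * q%:R ^+ 2 * N =
      ((5 * m%:R ^+ 2 + drift_const R m) * N) * (E * q%:R ^+ 2) by ring.
  apply: ler_wpM2r => //.
  have : 5 * m%:R ^+ 2 <= 5 * m%:R ^+ 2 * N by rewrite ler_peMr// mulr_ge0// exprn_ge0.
  by lra.
- by move=> l; rewrite addr_ge0 ?sqr_ge0.
- by move=> x vx; exact: modularity_pa_graph_ge.
Unshelve. all: by end_near. Qed.

(** Take eps n = - 1 / (k + 1) for the largest k <= n such that P n at this point is at
    least 1 - 1 / (k + 1).  Such a k exists, as k = 0 always qualifies, and it tends to
    infinity with n. *)
Lemma diagonal_limit (P : nat -> R -> R) :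
  (forall n e, 0 <= P n e <= 1) ->
  (forall e d, 0 < e -> 0 < d -> \forall n \near \oo, 1 - d <= P n (- e))%classic ->
  exists2 eps : nat -> R, (eps @ \oo --> (0 : R))%classic &
    ((fun n => P n (eps n)) @ \oo --> (1 : R))%classic.
Proof.
move=> P01 Plim.
pose good n (k : 'I_n.+1) := 1 - k.+1%:R^-1 <= P n (- k.+1%:R^-1).
pose kap n : nat := [arg max_(k > ord0 | @good n k) val k].
have kapP n : @good n [arg max_(k > ord0 | @good n k) val k] /\
    forall k : 'I_n.+1, good n k -> (k <= kap n)%N.
  rewrite /kap; case: arg_maxnP => [|i gi imax]; last by split.
  by rewrite /good invr1 subrr; case/andP: (P01 n (-1)).
pose eps n : R := - (kap n).+1%:R^-1.
have eps0 : (eps @ \oo --> (0 : R))%classic.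
  rewrite -oppr0; apply: cvgN; apply/cvgr0Pnorm_le => e e0.
  have ke := archi_boundP (ltW (_ : 0 < e^-1)); rewrite invr_gt0 in ke.
  move: (ke e0); set k := Num.bound _ => {}ke.
  have k1e : k.+1%:R^-1 <= e.
    rewrite invf_ple ?posrE ?ltr0n// (le_trans (ltW ke))// ler_nat.
    exact: leqnSn.
  near=> n.
  have kn : (k < n.+1)%N by rewrite ltnS; near: n; exact: nbhs_infty_ge.
  have gk : good n (Ordinal kn).
    by rewrite /good /=; near: n; apply: Plim; rewrite invr_gt0.
  have kk := (kapP n).2 _ gk.
  rewrite ger0_norm// (le_trans _ k1e)//.
  by rewrite lef_pV2 ?posrE ?ltr0n// ler_nat ltnS.
exists eps => //.
apply: (@squeeze_cvgr _ _ _ _ (fun n => 1 + eps n) (fun=> 1)).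
- apply: nearW => n; case/andP: (P01 n (eps n)) => _ ->; rewrite andbT.
  by case: (kapP n).
- have : ((fun n => 1 + eps n) @ \oo --> (1 + 0 : R))%classic.
    by apply: cvgD => //; exact: cvg_cst.
  by rewrite addr0.
- exact: cvg_cst.
Unshelve. all: by end_near. Qed.

Lemma le_pa_prob m n (E E' : mgraph 'I_n -> bool) :
  (forall G, E G -> E' G) -> pa_prob R m E <= pa_prob R m E'.
Proof.
move=> EE'; rewrite /pa_prob big_mkcond [leRHS]big_mkcond /=.
apply: ler_sum => x _; case: ifP => [/EE'->//|_].
by case: ifP => // _; exact: pa_law_ge0.
Qed.

Lemma pa_prob_ge0 m n (E : mgraph 'I_n -> bool) : 0 <= pa_prob R m E.
Proof. by apply: sumr_ge0 => x _; exact: pa_law_ge0. Qed.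

Lemma pa_prob_modularity_near m (b d : R) : (0 < m)%N ->
  b < mean_abs R m / (2 * m%:R) -> 0 < d ->
  (\forall n \near \oo,
    1 - d <= pa_prob R m (fun G : mgraph 'I_n => b <= modularity R G)%R)%classic.
Proof.
move=> m0; rewrite -subr_gt0; set e := _ - b => e0 d0.
pose q := (Num.bound (2 / e)).+1.
have qe : 2 / q%:R <= e.
  have := archi_boundP (ltW (divr_gt0 (ltr0n R 2) e0)).
  rewrite ltr_pdivrMr// => qe; rewrite ler_pdivrMr ?ltr0n// (le_trans (ltW qe))//.
  by rewrite mulrC ler_pM2l// ler_nat.
have := pa_prob_modularity_ge m0 (ltn0Sn _ : (0 < q)%N) d0.
apply: filterS => n /le_trans; apply; apply: le_pa_prob => G; apply: le_trans.
by rewrite /e in qe; lra.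
Qed.

Lemma pa_modularity_aas_ge_mean_abs m : (0 < m)%N ->
  pa_modularity_aas_ge m (mean_abs R m / (2 * m%:R)).
Proof.
move=> m0; set a := _ / _.
apply: (@diagonal_limit (fun n e =>
  pa_prob R m (fun G : mgraph 'I_n => a + e <= modularity R G))).
  by move=> n e; rewrite pa_prob_ge0 pa_prob_le1.
by move=> e d e0 d0; apply: pa_prob_modularity_near => //; rewrite gtrDl oppr_lt0.
Qed.

Lemma pa_aas_modularity_gt m (b : R) : (0 < m)%N ->
  b < mean_abs R m / (2 * m%:R) ->
  pa_aas R m (fun n (G : mgraph 'I_n) => b <= modularity R G).
Proof.
move=> m0 ba; apply/cvgrPdist_le => d d0.
have := pa_prob_modularity_near m0 ba d0; apply: filterS => n pn.
by rewrite ger0_norm ?subr_ge0 ?pa_prob_le1// lerBlDr -lerBlDl.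
Qed.

End Assembly.

Theorem theorem12 (R : realType) :
  (forall m : nat, (1 <= m)%N ->
     [/\ pa_modularity_aas_ge m (m%:R^-1 * binomial_mean_dev R m),
         (~~ odd m ->
          pa_modularity_aas_ge m
            ((2 : R) ^ (1 - m%:Z) / m%:R *
             \sum_(1 <= i < (m./2).+1) i%:R * 'C(m, m./2 + i)%:R)) &
         (odd m ->
          pa_modularity_aas_ge m
            ((2 : R) ^ (1 - m%:Z) / m%:R *
             \sum_(1 <= i < ((m.+1)./2).+1)
                (i%:R - 2^-1) * 'C(m, (m.-1)./2 + i)%:R))])
  /\
  (exists2 c : R, 0 < c &
     forall m : nat, (1 <= m)%N ->
       pa_aas R m (fun n (G : mgraph 'I_n) =>
         c / Num.sqrt m%:R <= modularity R G)).
Proof.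
split=> [m m1|].
  have aas := pa_modularity_aas_ge_mean_abs R m1.
  split=> [|em|om].
  - rewrite binomial_mean_devE.
    suff -> : m%:R^-1 * (mean_abs R m / 2) = mean_abs R m / (2 * m%:R) by [].
    by rewrite invfM; ring.
  - move: aas; rewrite mean_absE (_ : m.+1 - m./2 = (m./2).+1)%N; last by lia.
    rewrite (_ : \sum_(1 <= i < _) _ =
        \sum_(1 <= i < (m./2).+1) i%:R * 'C(m, m./2 + i)%:R)//.
    apply: eq_bigr => i _; congr (_ * _).
    rewrite [in X in _ - X / 2](_ : m = (m./2 * 2)%N); last by lia.
    by rewrite natrM; field.
  - move: aas; rewrite mean_absE (_ : m.+1 - m./2 = (m.+1)./2.+1)%N; last by lia.
    rewrite (_ : \sum_(1 <= i < _) _ = \sum_(1 <= i < (m.+1)./2.+1)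
       (i%:R - 2^-1) * 'C(m, (m.-1)./2 + i)%:R)//.
    apply: eq_bigr => i _; rewrite (_ : (m.-1)./2 = m./2)%N; last by lia.
    congr (_ * _); rewrite [in X in _ - X / 2](_ : m = (m./2 * 2).+1)%N; last by lia.
    by rewrite -natr1 natrM; field.
exists 16^-1 => // m m1; apply: pa_aas_modularity_gt => //.
have s0 : 0 < Num.sqrt (m%:R : R) by rewrite sqrtr_gt0 ltr0n.
have s2 : Num.sqrt (m%:R : R) ^+ 2 = m%:R by rewrite sqr_sqrtr.
have := coin_mean_abs_ge R m; rewrite -/(mean_abs R m) -[X in 2 * X]s2.
move: s0 {s2}; move: (Num.sqrt _) (mean_abs R m) => s D s0 Ds.
rewrite ltr_pdivlMr ?mulr_gt0 ?exprn_gt0//.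
rewrite (_ : 16^-1 / s * (2 * s ^+ 2) = s / 8); last by field; rewrite gt_eqF.
lra.
Qed.
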